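(* Let $m$ be a positive integer and $\lambda$ a nonzero real number. For integers $n\ge1$ and $0\le k\le n$, $$W_{m,\lambda}(n,k)=W_{m,\lambda}(n-1,k-1)+(mk+1)W_{m,\lambda}(n-1,k)-\lambda(n-1)W_{m,\lambda}(n-1,k),$$ with the convention $W_{m,\lambda}(n-1,-1)=0$ and $W_{m,\lambda}(n-1,n)=0$.
   Context: For a nonzero real $\lambda$: $(x)_{0,\lambda}=1$, $(x)_{n,\lambda}=x(x-\lambda)\cdots(x-(n-1)\lambda)$ for $n\ge1$; $(x)_n=(x)_{n,1}$. The degenerate Whitney numbers of the second kind $W_{m,\lambda}(n,k)$ are defined by $(mx+1)_{n,\lambda}=\sum_{k=0}^{n}W_{m,\lambda}(n,k)m^{k}(x)_{k}$ for $n\ge0$, and $W_{m,\lambda}(n,k)=0$ if $k<0$ or $k>n$. *)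

(* Defs.v *)
From HB Require Import structures.
From mathcomp Require Import all_boot all_order all_algebra.
From mathcomp Require Import boolp reals.

Set Implicit Arguments.
Unset Strict Implicit.
Unset Printing Implicit Defensive.

Import Order.TTheory GRing.Theory Num.Theory.
Local Open Scope ring_scope.

(* (x)_{n,l}; the ordinary falling factorial (x)_n is the case l = 1. *)
Definition dfall (A : comNzRingType) (l x : A) (n : nat) : A :=
  \prod_(i < n) (x - i%:R * l).

(* The second index is an integer so that the vanishing for k < 0 can be
   stated. *)
Record degenerate_whitney2 (R : realType) (m : nat) (l : R)
    (W : nat -> int -> R) : Prop := DegenerateWhitney2 {
  whitney2_expansion : forall (n : nat) (x : R),
    dfall l (m%:R * x + 1) n =
    \sum_(k < n.+1) W n (k : nat)%:Z * m%:R ^+ k * dfall 1 x k;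
  whitney2_out : forall (n : nat) (k : int),
    (k < 0) || (n%:Z < k) -> W n k = 0
}.

Lemma graded_span (F : fieldType) (q : nat -> {poly F}) :
  (forall k, size (q k) = k.+1) ->
  forall n (p : {poly F}), (size p <= n)%N ->
  exists c : nat -> F, p = \sum_(k < n) c k *: q k.
Proof.
move=> sq; elim=> [|n IHn] p sp.
  exists (fun=> 0); rewrite big_ord0; apply/eqP.
  by rewrite -size_poly_eq0 -leqn0.
have qn0 : (q n)`_n != 0.
  have -> : (q n)`_n = lead_coef (q n) by rewrite /lead_coef sq.
  by rewrite lead_coef_eq0 -size_poly_eq0 sq.
pose a := p`_n / (q n)`_n.
have [|c Ec] := IHn (p - a *: q n).
  apply/leq_sizeP => j; rewrite leq_eqVlt => /predU1P[<-|ltnj].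
    by rewrite coefB coefZ divfK // subrr.
  rewrite coefB coefZ (nth_default _ (leq_trans sp ltnj)).
  by rewrite (nth_default _ (_ : size (q n) <= j)%N) ?sq // mulr0 subrr.
exists (fun k => if (k < n)%N then c k else a).
rewrite big_ord_recr /= ltnn -[LHS](subrK (a *: q n)) Ec; congr (_ + _).
by apply: eq_bigr => i _; rewrite ltn_ord.
Qed.

Lemma horner_dfall (F : fieldType) (l x : F) (p : {poly F}) n :
  (dfall l%:P p n).[x] = dfall l p.[x] n.
Proof.
by rewrite /dfall horner_prod; apply: eq_bigr => i _; rewrite -polyC_natr !hornerE.
Qed.

Lemma degenerate_whitney2_exists (R : realType) (m : nat) (l : R) :
  (0 < m)%N -> exists W : nat -> int -> R, degenerate_whitney2 m l W.
Proof.
move=> m0; have mR : m%:R != 0 :> R by rewrite pnatr_eq0 -lt0n.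
have sq k : size (m%:R ^+ k *: dfall (1 : R)%:P 'X k) = k.+1.
  rewrite size_scale ?expf_neq0 // /dfall.
  under eq_bigr => i _ do rewrite -polyC_natr -polyCM.
  by rewrite size_prod_XsubC /index_enum -enumT size_enum_ord.
have sp n : (size (dfall l%:P (m%:R *: 'X + 1 : {poly R}) n) <= n.+1)%N.
  rewrite /dfall; elim: n => [|n IHn]; first by rewrite big_ord0 size_poly1.
  rewrite big_ord_recr /=; apply: leq_trans (size_polyMleq _ _) _.
  have h : (size (m%:R *: 'X + 1 - n%:R * l%:P : {poly R})%R <= 2)%N.
    rewrite -polyC_natr -polyCM -addrA -polyC1 -polyCB.
    apply: leq_trans (size_polyD _ _) _; rewrite geq_max.
    rewrite (leq_trans (size_scale_leq _ _)) ?size_polyX //=.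
    exact: leq_trans (size_polyC_leq1 _) _.
  have := leq_add IHn h; rewrite addn2.
  by case: (_ + _)%N.
have /choice[c Ec] n := graded_span sq (sp n).
exists (fun n k => if k is Posz j then if (j <= n)%N then c n j else 0 else 0).
split=> [n x|n [j|j] //=]; last by rewrite ltz_nat => /ltn_geF ->.
have /(congr1 (fun p => p.[x])) := Ec n.
rewrite horner_dfall !hornerE horner_sum => ->; apply: eq_bigr => k _.
by rewrite -ltnS ltn_ord !hornerZ horner_dfall hornerX mulrA.
Qed.

(* Main.v *)
(** Multiplying the expansion of (mx+1)_{p,l} by mx + 1 - pl = m(x-k) + (mk+1-pl)
    and using (x)_k (x-k) = (x)_{k+1} expands (mx+1)_{p+1,l} in the basis
    m^k (x)_k with the claimed coefficients.  Coefficients in this basis are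
    unique: at x = j the terms k > j vanish and (j)_j <> 0, so the system is
    triangular. *)
Require Import Defs.
From HB Require Import structures.
From mathcomp Require Import all_boot all_order all_algebra.
From mathcomp Require Import boolp reals.
From mathcomp Require Import ring.

Set Implicit Arguments.
Unset Strict Implicit.
Unset Printing Implicit Defensive.

Import Order.TTheory GRing.Theory Num.Theory.
Local Open Scope ring_scope.

Lemma dfallS (A : comNzRingType) (l x : A) n :
  dfall l x n.+1 = dfall l x n * (x - n%:R * l).
Proof. exact: big_ord_recr. Qed.

(** The factor [j - j] occurs in the product exactly when [j < k]; in characteristic zero no other
    factor vanishes. *)
Lemma dfall1_nat_eq0 (F : numFieldType) (j k : nat) :
  (dfall 1 j%:R k == 0 :> F) = (j < k)%N.
Proof.
elim: k => [|k IHk]; first by rewrite /dfall big_ord0 oner_eq0 ltn0.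
by rewrite dfallS mulf_eq0 IHk mulr1 subr_eq0 eqr_nat ltnS orbC -leq_eqVlt.
Qed.

Lemma dfall1_free (F : numFieldType) (N : nat) (a : nat -> F) :
  (forall j : nat, \sum_(k < N) a k * dfall 1 j%:R k = 0) ->
  forall k, (k < N)%N -> a k = 0.
Proof.
move=> a0; elim/ltn_ind => j IHj jN; have := a0 j.
(* Only the term of index [j] survives: [a i = 0] by induction for [i < j], and [(j)_i = 0] for
   [i > j]. *)
rewrite (bigD1 (Ordinal jN)) //= big1 => [|i ineqj].
  by rewrite addr0 => /eqP; rewrite mulf_eq0 dfall1_nat_eq0 ltnn orbF => /eqP.
case: (ltngtP i j) => [ij|ji|Eij].
- by rewrite IHj ?mul0r.
- by have /eqP-> : dfall 1 j%:R i == 0 :> F; rewrite ?mulr0 ?dfall1_nat_eq0.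
- by case/eqP: ineqj; exact: val_inj.
Qed.

Lemma whitney2_expansionS (R : realType) (m : nat) (l : R)
    (W : nat -> int -> R) (hW : degenerate_whitney2 m l W) (p : nat) (x : R) :
  dfall l (m%:R * x + 1) p.+1 =
  \sum_(k < p.+2) (W p (k%:Z - 1) + (m%:R * k%:R + 1 - l * p%:R) * W p k%:Z)
                  * m%:R ^+ k * dfall 1 x k.
Proof.
under eq_bigr do rewrite mulrDl mulrDl.
(* The first sum loses its term [k = 0] and the second its term [k = p + 1], as [W p] vanishes at
   [-1] and [p + 1]. After a shift in the first, both run over [k <= p]. *)
rewrite big_split /= big_ord_recl [X in _ = _ + X]big_ord_recr /=.
rewrite (whitney2_out hW (k := 0%:Z - 1)) //.
rewrite (whitney2_out hW (k := p.+1%:Z)) ?ltz_nat ?ltnSn ?orbT //.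
rewrite mulr0 !mul0r add0r addr0 -big_split /=.
rewrite dfallS (whitney2_expansion hW) big_distrl /=.
apply: eq_bigr => k _; rewrite /bump /= add1n -[k.+1]addn1 PoszD addrK addn1.
rewrite dfallS exprS; ring.
Qed.

Theorem theorem6 (R : realType) (m : nat) (l : R) (W : nat -> int -> R)
    (m_gt0 : (0 < m)%N) (l_neq0 : l != 0) (hW : degenerate_whitney2 m l W)
    (n k : nat) (n_ge1 : (1 <= n)%N) (k_le_n : (k <= n)%N) :
  W n k%:Z =
    W (n - 1)%N (k%:Z - 1) + (m%:R * k%:R + 1) * W (n - 1)%N k%:Z
    - l * (n%:R - 1) * W (n - 1)%N k%:Z.
Proof.
case: n n_ge1 k_le_n => // p _ k_le; rewrite subn1 /= -natr1 addrK.
rewrite -addrA -mulrBl.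
pose b k := W p (k%:Z - 1) + (m%:R * k%:R + 1 - l * p%:R) * W p k%:Z.
(* With the factor [m ^ k], which is nonzero since [m > 0], this is the coefficient of [(x)_k] in
   the difference of two expansions of the same function. *)
suff /(_ k k_le)/eqP : forall k, (k < p.+2)%N ->
    (W p.+1 k%:Z - b k) * m%:R ^+ k = 0.
  by rewrite mulf_eq0 expf_eq0 pnatr_eq0 eqn0Ngt m_gt0 andbF orbF subr_eq0 => /eqP.
apply: (dfall1_free (a := fun k => (W p.+1 k%:Z - b k) * m%:R ^+ k)) => j.
under eq_bigr do rewrite !mulrBl.
by rewrite sumrB -(whitney2_expansion hW) (whitney2_expansionS hW) subrr.
Qed.
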